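(* Let $A$ be an integral domain whose fraction field $\mathcal{K}(A)$ is formally real, let $\alpha\in\operatorname{Spec}_rA$, and let $s=\operatorname{s}(\operatorname{Spec}_rA\setminus\operatorname{Spec}_cA)$ be the stability index of the open set $\operatorname{Spec}_rA\setminus\operatorname{Spec}_cA$. The following properties are equivalent: (1) $\alpha\in\operatorname{Spec}_cA$. (2) For any $f_1,\ldots,f_k\in A$ such that $\alpha\in\mathcal{S}(f_1,\ldots,f_k)$ and $k\leq s$, the cone $\sum\mathcal{K}(A)^2[f_1,\ldots,f_k]$ is proper in $\mathcal{K}(A)$. (3) For any $f_1,\ldots,f_k\in A$ such that $\alpha\in\mathcal{S}(f_1,\ldots,f_k)$ and $k\leq s$, the cone $A\cap\sum\mathcal{K}(A)^2[f_1,\ldots,f_k]$ is proper in $A$. (4) For any $f_1,\ldots,f_k\in A$ such that $\alpha\in\mathcal{S}(f_1,\ldots,f_k)$ and $k\leq s$, the intersection $\mathcal{S}(f_1,\ldots,f_k)\cap\operatorname{Spec}_cA$ is non-empty. (5) For any $f_1,\ldots,f_k\in A$ such that $\alpha\in\mathcal{S}(f_1,\ldots,f_k)$ and $k\leq s$, one has $A\cap\sum\mathcal{K}(A)^2[f_1,\ldots,f_k]\subset P_\alpha$.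
   Context: All rings are commutative and contain $\mathbb{Q}$. A field is formally real if $-1$ is not a sum of squares. $\sum\mathcal{K}(A)^2$ is the set of sums of squares of elements of $\mathcal{K}(A)$. A cone of a ring $B$ is a subset $P\subset B$ with $P+P\subset P$, $P\cdot P\subset P$ and $b^2\in P$ for all $b\in B$; it is proper if $-1\notin P$. If $P$ is a cone of $B$ then $P[f_1,\ldots,f_k]$ denotes the smallest cone of $B$ containing $P$ and $f_1,\ldots,f_k$ (equal to $P$ if $k=0$); $\sum\mathcal{K}(A)^2[f_1,\ldots,f_k]$ is a cone of $\mathcal{K}(A)$, and $A\cap\sum\mathcal{K}(A)^2[f_1,\ldots,f_k]$ means the intersection of $A$ with this cone. An ordering of $B$ is a proper cone $P$ such that $ab\in P$ implies $a\in P$ or $-b\in P$; $\operatorname{Spec}_rB$ is the set of orderings of $B$. For $\alpha\in\operatorname{Spec}_rA$, write $P_\alpha$ for the corresponding cone and $\operatorname{supp}(\alpha)=P_\alpha\cap -P_\alpha$; $a(\alpha)>0$ means $a\in P_\alpha\setminus\operatorname{supp}(\alpha)$. Basic open sets are the sets $\mathcal{S}(f_1,\ldots,f_k)=\{\alpha\in\operatorname{Spec}_rA\mid f_1(\alpha)>0,\ldots,f_k(\alpha)>0\}$ (all of $\operatorname{Spec}_rA$ if $k=0$); they generate the topology of $\operatorname{Spec}_rA$. The map $Q\mapsto Q\cap A$ identifies $\operatorname{Spec}_r\mathcal{K}(A)$ with the set of orderings of $A$ with support $(0)$; $\operatorname{Spec}_cA:=\overline{\operatorname{Spec}_r\mathcal{K}(A)}$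 (closure in $\operatorname{Spec}_rA$). The stability index $\operatorname{s}(U)$ of an open subset $U$ of $\operatorname{Spec}_rA$ is the infimum of the $k\in\mathbb{N}$ such that every basic open set $S\subset U$ can be written $S=\mathcal{S}(f_1,\ldots,f_k)$ for some $f_1,\ldots,f_k\in A$; by convention $\operatorname{s}(\emptyset)=0$. *)

(* Defs.v *)
From HB Require Import structures.
From mathcomp Require Import all_boot all_order all_algebra.
From mathcomp Require Import boolp classical_sets topology.

Set Implicit Arguments.
Unset Strict Implicit.
Unset Printing Implicit Defensive.

Import GRing.Theory.
Local Open Scope classical_set_scope.
Local Open Scope ring_scope.

Definition contains_rat (A : nzRingType) : Prop :=
  exists iota : {rmorphism rat -> A}, injective iota.

Definition sums_of_squares (B : comNzRingType) : set B :=
  [set x | exists s : seq B, x = \sum_(y <- s) y ^+ 2].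
Arguments sums_of_squares B : clear implicits.

Definition formally_real (F : fieldType) : Prop := ~ sums_of_squares F (- 1).

Section Cones.
Variable B : comNzRingType.
Implicit Type P : set B.

Definition cone P : Prop :=
  [/\ forall a b, P a -> P b -> P (a + b),
      forall a b, P a -> P b -> P (a * b)
    & forall b, P (b ^+ 2)].

Definition proper_cone P : Prop := cone P /\ ~ P (- 1).

(* P[f_1, ..., f_k] *)
Definition cone_adjoin P (f : seq B) : set B :=
  smallest cone (P `|` [set` f]).

Definition ordering P : Prop :=
  proper_cone P /\ forall a b, P (a * b) -> P a \/ P (- b).

End Cones.

Record Spec_r (B : comNzRingType) := MkSpec_r {
  pos_cone : set B;
  pos_coneP : ordering pos_cone }.

HB.instance Definition _ (B : comNzRingType) := gen_eqMixin (Spec_r B).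
HB.instance Definition _ (B : comNzRingType) := gen_choiceMixin (Spec_r B).

Section RealSpectrum.
Variable B : comNzRingType.
Implicit Types (alpha : Spec_r B) (f g : seq B) (U : set (Spec_r B)).

Definition supp alpha : set B := [set a | pos_cone alpha a /\ pos_cone alpha (- a)].

Definition pos_at alpha (a : B) : Prop := pos_cone alpha a /\ ~ supp alpha a.

(* S(f_1, ..., f_k) *)
Definition basic_open f : set (Spec_r B) :=
  [set alpha | forall a, a \in f -> pos_at alpha a].

Lemma basic_open_cover : \bigcup_(f in setT) basic_open f = setT.
Proof. by apply/seteqP; split=> // alpha _; exists [::]. Qed.

Lemma basic_open_join f g alpha : setT f -> setT g ->
  basic_open f alpha -> basic_open g alpha ->
  exists h, [/\ setT h, basic_open h alpha
    & basic_open h `<=` basic_open f `&` basic_open g].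
Proof.
move=> _ _ fa ga; exists (f ++ g); split=> // [a|beta fgb].
  by rewrite mem_cat => /orP[/fa|/ga].
by split=> a af; apply: fgb; rewrite mem_cat af ?orbT.
Qed.

End RealSpectrum.

(* The index type of a base must be pointed, hence the instance on seq. *)
HB.instance Definition _ (B : comNzRingType) := isPointed.Build (seq B) [::].

HB.instance Definition _ (B : comNzRingType) :=
  isBaseTopological.Build (Spec_r B)
    (@basic_open_cover B) (@basic_open_join B).

Lemma ordering_preimage (A B : comNzRingType) (phi : {rmorphism A -> B})
  (Q : Spec_r B) : ordering (phi @^-1` pos_cone Q).
Proof.
case: (pos_coneP Q) => -[[QD QM QX] QN1] Qpr; split; first split; first split.
- by move=> a b /= Qa Qb; rewrite rmorphD; apply: QD.
- by move=> a b /= Qa Qb; rewrite rmorphM; apply: QM.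
- by move=> b /=; rewrite rmorphXn; apply: QX.
- by rewrite /= rmorphN1.
- by move=> a b /=; rewrite rmorphM rmorphN; apply: Qpr.
Qed.

Definition Spec_r_map (A B : comNzRingType) (phi : {rmorphism A -> B})
  (Q : Spec_r B) : Spec_r A := MkSpec_r (ordering_preimage phi Q).

Definition Spec_c (A : idomainType) : set (Spec_r A) :=
  closure (range (Spec_r_map (@tofrac A))).
Arguments Spec_c A : clear implicits.

Definition basic_opens_need (A : comNzRingType) (U : set (Spec_r A))
    (k : nat) : Prop :=
  forall g : seq A, basic_open g `<=` U ->
  exists f : k.-tuple A, basic_open g = basic_open f.

(* The infimum is taken in the naturals extended with an infinite value:
   [Some k] is the finite value k, and [None] is the infimum of the empty set.
   s(set0) = 0 is a convention: the infimum for set0 would be 1, since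
   set0 = S(0) while S() is the whole spectrum. *)
Definition stability_index (A : comNzRingType) (U : set (Spec_r A)) :
    option nat :=
  if pselect (U = set0) then Some 0%N
  else if pselect (exists k, `[< basic_opens_need U k >]) is left exk
       then Some (ex_minn exk)
       else None.

Definition le_index (k : nat) (s : option nat) : bool :=
  if s is Some n then (k <= n)%N else true.

(* The cone of K(A) written $\sum K(A)^2[f_1, ..., f_k]$, for f_i in A *)
Definition frac_cone (A : idomainType) (f : seq A) : set {fraction A} :=
  cone_adjoin (sums_of_squares {fraction A}) [seq tofrac a | a <- f].

(* Main.v *)
Require Import Defs.
From HB Require Import structures.
From mathcomp Require Import all_boot all_order all_algebra.
From mathcomp Require Import boolp classical_sets topology.
From mathcomp Require Import ring.

(** The equivalence rests on two facts about a basic open set S(f) whose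
    members f_i are nonzero.

    The first is algebraic: S(f) meets Spec_c A if and only if the cone
    generated by the f_i in the fraction field is proper
    ([basic_open_meets_Spec_c]).  A nonempty intersection with the closure
    contains an ordering of the field at which the f_i are positive, and the
    cone lies inside that ordering; conversely a proper cone of a field extends
    to an ordering by Zorn's lemma ([proper_cone_in_ordering]).  This makes
    (2), (3) and (4) three readings of the same condition, and it yields
    (1) => (2), since alpha itself lies in the intersection.

    The second is what the stability index is for: a basic open set that misses
    Spec_c A and contains alpha can be rewritten with at most s inequalities
    ([basic_open_shrink]), so conditions limited to k <= s still apply to it.
    For (4) => (5), if a is in the cone of f but not in P_alpha, then
    S(f, -a) contains alpha and misses Spec_c A: at every field ordering where
    the f_i are positive, a is nonnegative.  Rewriting S(f, -a) with at most s
    inequalities contradicts (4).  For (5) => (1), a point outside the closure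
    has a basic neighbourhood S(f) missing Spec_c A, which may be taken with at
    most s inequalities; its cone is improper, so -1 would belong to P_alpha. *)

Set Implicit Arguments.
Unset Strict Implicit.
Unset Printing Implicit Defensive.

Import GRing.Theory.
Local Open Scope classical_set_scope.
Local Open Scope ring_scope.

(** * Cones *)

Section Cones.
Variable B : comNzRingType.
Implicit Type P : set B.

Lemma cone0 P : cone P -> P 0.
Proof. by move=> [_ _ PX]; have := PX 0; rewrite expr0n. Qed.

Lemma cone1 P : cone P -> P 1.
Proof. by move=> [_ _ PX]; have := PX 1; rewrite expr1n. Qed.

Lemma sums_of_squares_sub_cone P : cone P -> sums_of_squares B `<=` P.
Proof.
move=> cP _ [s ->]; have [PD _ PX] := cP.
by elim/big_ind: _ => [|//|y _]; [exact: cone0|exact: PX].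
Qed.

Lemma cone_adjoin_cone P (f : seq B) : cone (cone_adjoin P f).
Proof.
split=> [a b Pa Pb|a b Pa Pb|b] Q QP; have [QD QM QX] := QP.1.
- by apply: QD; [exact: Pa|exact: Pb].
- by apply: QM; [exact: Pa|exact: Pb].
- exact: QX.
Qed.

Lemma cone_adjoin_sub P Q (f : seq B) : cone Q -> P `<=` Q ->
  (forall a, a \in f -> Q a) -> cone_adjoin P f `<=` Q.
Proof. by move=> cQ PQ fQ; apply: smallest_sub => // a [/PQ|/fQ]. Qed.

Lemma mem_cone_adjoin P (f : seq B) a : a \in f -> cone_adjoin P f a.
Proof. by move=> fa Q [_]; apply; right. Qed.

End Cones.

(** * Basic open sets of the real spectrum *)

Section Orderings.
Variable B : comNzRingType.
Implicit Types (alpha : Spec_r B) (f g : seq B) (U : set (Spec_r B)).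

(** The primality condition, applied to a * a, puts a or -a in the cone, so
    strict positivity is the failure of -a to be nonnegative. *)
Lemma pos_atE alpha a : pos_at alpha a <-> ~ pos_cone alpha (- a).
Proof.
have [[[_ _ PX] _] Ppr] := pos_coneP alpha; split.
  by move=> [Pa nsa] PNa; apply: nsa.
move=> nPNa; split=> [|[]//].
by case: (Ppr a a) => //; rewrite -expr2; apply: PX.
Qed.

Lemma pos_at_neq0 alpha a : pos_at alpha a -> a != 0.
Proof.
rewrite pos_atE; apply: contra_notN => /eqP ->; rewrite oppr0.
by apply: cone0; case: (pos_coneP alpha) => -[].
Qed.

Lemma basic_open_neq0 alpha f : basic_open f alpha -> 0 \notin f.
Proof. by move=> fP; apply/negP => /fP/pos_at_neq0; rewrite eqxx. Qed.

Lemma open_basic_open f : open (basic_open f).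
Proof. by exists [set f] => //; rewrite bigcup_set1. Qed.

Lemma closure_basicP (E : set (Spec_r B)) alpha : closure E alpha <->
  forall f, basic_open f alpha -> E `&` basic_open f !=set0.
Proof.
split=> [clE f fP|Ef V].
  apply: clE; rewrite nbhsE /=; exists (basic_open f) => //.
  by split=> //; exact: open_basic_open.
rewrite nbhsE /= => -[W [[D _ <-] [f Df fP]] sub].
have [beta [Eb fb]] := Ef f fP; exists beta; split=> //.
by apply: sub; exists f.
Qed.

(** The point alpha excludes the empty open set, whose index 0 is a convention
    and does not allow rewriting S(0) as S(). *)
Lemma basic_open_shrink U g alpha : basic_open g `<=` U -> basic_open g alpha ->
  exists k (f : k.-tuple B),
    le_index k (stability_index U) /\ basic_open g = basic_open f.
Proof.
move=> gU gP; rewrite /stability_index; case: pselect => [U0|/= _].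
  by move: (gU _ gP); rewrite {1}U0.
case: pselect => [exk|_]; last by exists (size g), (in_tuple g).
case: ex_minnP => k /asboolP needk _.
by have [f gf] := needk _ gU; exists k, f; split=> //=.
Qed.

End Orderings.

(** * Extending a proper cone of a field to an ordering *)

Section FieldOrderings.
Variable F : fieldType.
Implicit Type P : set F.

(** A nonzero x with x and -x in P would give -1 = x (-x) x^-2 in P. *)
Lemma proper_cone_antisym P x : proper_cone P -> P x -> P (- x) -> x = 0.
Proof.
move=> [[PD PM PX] PN1] Px PNx; apply/eqP/negPn/negP => x0; apply: PN1.
by have -> : -1 = x * (- x) * x^-1 ^+ 2 by [field]; apply: (PM); [exact: PM|].
Qed.

(** This is P[-a]: if it contained -1 = p - a q, then a q = 1 + p would be in
    P, and so would a = (a q) q q^-2. *)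
Lemma proper_cone_extend P a : proper_cone P -> ~ P a ->
  proper_cone [set x | exists p q, [/\ P p, P q & x = p - a * q]].
Proof.
move=> [cP PN1] nPa; have [PD PM PX] := cP; split; first split.
- move=> _ _ [p [q [Pp Pq ->]]] [p' [q' [Pp' Pq' ->]]].
  by exists (p + p'), (q + q'); split; [exact: PD|exact: PD|ring].
- move=> _ _ [p [q [Pp Pq ->]]] [p' [q' [Pp' Pq' ->]]].
  exists (p * p' + a ^+ 2 * (q * q')), (p * q' + q * p'); split; last by ring.
  + by apply: (PD); [exact: PM|apply: (PM) => //; exact: PM].
  + by apply: PD; exact: PM.
- by move=> b; exists (b ^+ 2), 0; split=> //; [exact: cone0|ring].
- move=> [p [q [Pp Pq N1E]]].
  have aqE : a * q = 1 + p by rewrite -[1]opprK N1E; ring.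
  have q0 : q != 0.
    by apply: contra_notN PN1 => /eqP q0; rewrite N1E q0 mulr0 subr0.
  apply: nPa; have -> : a = (1 + p) * q * q^-1 ^+ 2 by rewrite -aqE; field.
  by apply: (PM) => //; apply: PM => //; apply: (PD) => //; exact: cone1.
Qed.

(** By maximality and [proper_cone_extend], x or -x is in P for every x.  If
    neither a nor -b were in P, then -a and b would be, so a b would lie in P
    and in -P; hence a b = 0 and one of a, -b is 0, which is in P. *)
Lemma maximal_proper_cone_ordering P : proper_cone P ->
  (forall Q, proper_cone Q -> P `<=` Q -> Q `<=` P) -> ordering P.
Proof.
move=> pP maxP; split=> // a b Pab; apply: contrapT => /not_orP[nPa nPNb].
have total x : ~ P x -> P (- x).
  move=> nPx; apply: (maxP _ (proper_cone_extend pP nPx)).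
    by move=> p Pp; exists p, 0; split=> //; [exact: (cone0 pP.1)|ring].
  exists 0, 1; split; [exact: (cone0 pP.1)|exact: (cone1 pP.1)|by ring].
have PNab : P (- (a * b)).
  case: (pP) => -[_ PM _] _; rewrite -mulNr; apply: PM; first exact: total.
  by rewrite -[b]opprK; exact: total.
have /eqP := proper_cone_antisym pP Pab PNab.
rewrite mulf_eq0 => /orP[] /eqP x0.
  by apply: nPa; rewrite x0; exact: (cone0 pP.1).
by apply: nPNb; rewrite x0 oppr0; exact: (cone0 pP.1).
Qed.

Lemma proper_cone_in_ordering P : proper_cone P ->
  exists Q : Spec_r F, P `<=` pos_cone Q.
Proof.
move=> pP.
(* Joining P to every member of a chain covers the empty chain as well. *)
have [G FP Gtot|M [pM maxM]] := @Zorn_bigcup F (fun X => proper_cone (P `|` X)).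
  have [[PD PM PX] PN1] := pP.
  (* Two elements of the union already lie in a common proper cone. *)
  have common a b : (P `|` \bigcup_(X in G) X) a ->
      (P `|` \bigcup_(X in G) X) b ->
      exists C, [/\ proper_cone C, C a, C b & C `<=` P `|` \bigcup_(X in G) X].
    have sub X : G X -> P `|` X `<=` P `|` \bigcup_(Y in G) Y.
      by move=> GX x [Px|Xx]; [left|right; exists X].
    move=> [Pa|[X GX Xa]] [Pb|[Y GY Yb]].
    + by exists P; split=> // x; left.
    + by exists (P `|` Y); split; [exact: FP|left|right|exact: sub].
    + by exists (P `|` X); split; [exact: FP|right|left|exact: sub].
    + have [XY|YX] := Gtot X Y GX GY.
        by exists (P `|` Y); split; [exact: FP|right; exact: XY|right|exact: sub].
      by exists (P `|` X); split; [exact: FP|right|right; exact: YX|exact: sub].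
  split; first split.
  - by move=> a b Ua Ub; have [C [[[CD _ _] _] Ca Cb]] := common a b Ua Ub;
      apply; exact: CD.
  - by move=> a b Ua Ub; have [C [[[_ CM _] _] Ca Cb]] := common a b Ua Ub;
      apply; exact: CM.
  - by move=> b; left; exact: PX.
  - by move=> U1; have [C [[_ CN1] /CN1]] := common _ _ U1 U1.
have oM : ordering (P `|` M).
  apply: maximal_proper_cone_ordering => // Q pQ PMQ x Qx.
  apply: contrapT => nx; apply: (maxM Q); last first.
    by rewrite (_ : P `|` Q = Q) //; apply/setUidPr => y Py; apply: PMQ; left.
  split=> [y My|QM]; first by apply: PMQ; right.
  by apply: nx; right; exact: QM.
by exists (MkSpec_r oM) => x; left.
Qed.

End FieldOrderings.

(** * Central points and cones of the fraction field *)

Section CentralSpectrum.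
Variable A : idomainType.
Implicit Types (f : seq A) (alpha : Spec_r A) (Q : Spec_r {fraction A}).

Lemma frac_cone_sub Q f : basic_open f (Spec_r_map (@tofrac A) Q) ->
  frac_cone f `<=` pos_cone Q.
Proof.
have [[cQ _] _] := pos_coneP Q => fQ; apply: cone_adjoin_sub => //.
  exact: sums_of_squares_sub_cone.
by move=> _ /mapP[a /fQ[Qa _] ->].
Qed.

(** Basic open sets being open, one that meets the closure already meets the
    set of orderings induced from the fraction field; only there is the
    cone [frac_cone f] available for comparison. *)
Lemma Spec_c_field_point alpha f : Spec_c A alpha -> basic_open f alpha ->
  exists Q, basic_open f (Spec_r_map (@tofrac A) Q).
Proof.
by move=> /closure_basicP cA /cA[_ [[Q _ <-] fQ]]; exists Q.
Qed.

(** The f_i must be nonzero so that their images, which are only nonnegative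
    at an ordering containing the cone, are strictly positive there: a field
    ordering has support 0. *)
Lemma basic_open_meets_Spec_c f : 0 \notin f ->
  basic_open f `&` Spec_c A !=set0 <-> proper_cone (frac_cone f).
Proof.
move=> f0; split=> [[beta [fb cb]]|].
  have [Q fQ] := Spec_c_field_point cb fb.
  split; first exact: cone_adjoin_cone.
  by move=> /(frac_cone_sub fQ); case: (pos_coneP Q) => -[].
move=> /proper_cone_in_ordering[Q fQ].
have [pQ _] := pos_coneP Q.
exists (Spec_r_map (@tofrac A) Q); split; last first.
  by apply/closure_basicP => g gQ; eexists; split; [exists Q|exact: gQ].
move=> a fa; have Qa : pos_cone Q (tofrac a).
  by apply: fQ; apply: mem_cone_adjoin; exact: map_f.
split=> // -[_ /=]; rewrite rmorphN => QNa.
have /eqP := proper_cone_antisym pQ Qa QNa.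
by rewrite tofrac_eq0 => /eqP a0; move: f0; rewrite -a0 fa.
Qed.

(** At a field ordering where the f_i are positive, the cone of f is
    nonnegative, so the condition -a > 0 cannot hold there. *)
Lemma basic_open_frac_cone_disjoint_Spec_c f a : frac_cone f (tofrac a) ->
  basic_open (- a :: f) `<=` ~` Spec_c A.
Proof.
move=> fa beta fb cb; have [Q fQ] := Spec_c_field_point cb fb.
have /pos_atE : pos_at (Spec_r_map (@tofrac A) Q) (- a).
  by apply: fQ; rewrite mem_head.
apply; rewrite opprK /=; apply: frac_cone_sub fa => b fb'.
by apply: fQ; rewrite in_cons fb' orbT.
Qed.

End CentralSpectrum.

(** * The characterization of central points *)

Theorem theorem4p5 (A : idomainType) (hQ : contains_rat A)
    (hK : formally_real {fraction A}) (alpha : Spec_r A) :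
  let s := stability_index (~` Spec_c A) in
  [<-> Spec_c A alpha;
       forall (k : nat) (f : k.-tuple A), le_index k s ->
         basic_open f alpha -> proper_cone (frac_cone f);
       forall (k : nat) (f : k.-tuple A), le_index k s ->
         basic_open f alpha -> proper_cone (@tofrac A @^-1` frac_cone f);
       forall (k : nat) (f : k.-tuple A), le_index k s ->
         basic_open f alpha -> basic_open f `&` Spec_c A !=set0;
       forall (k : nat) (f : k.-tuple A), le_index k s ->
         basic_open f alpha -> @tofrac A @^-1` frac_cone f `<=` pos_cone alpha].
Proof.
move=> s; tfae.
- move=> ca k f _ fa; apply/basic_open_meets_Spec_c.
    exact: basic_open_neq0 fa.
  by exists alpha.
- move=> H k f ks fa; have [[CD CM CX] CN1] := H k f ks fa.
  split; first split.
  + by move=> a b /= Ca Cb; rewrite rmorphD; exact: CD.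
  + by move=> a b /= Ca Cb; rewrite rmorphM; exact: CM.
  + by move=> b /=; rewrite rmorphXn; exact: CX.
  + by rewrite /= rmorphN1.
- move=> H k f ks fa; have [_ CN1] := H k f ks fa.
  apply/basic_open_meets_Spec_c; first exact: basic_open_neq0 fa.
  split; first exact: cone_adjoin_cone.
  by move: CN1; rewrite /= rmorphN1.
- move=> H k f ks fa a /= Ca; apply: contrapT => nPa.
  have Nfa : basic_open (- a :: f) alpha.
    move=> b; rewrite in_cons => /orP[/eqP ->|]; last exact: fa.
    by apply/pos_atE; rewrite opprK.
  have disj := basic_open_frac_cone_disjoint_Spec_c Ca.
  (* f and -a may be s + 1 functions; [H] only accepts s of them. *)
  have [m [g [ms gE]]] := basic_open_shrink disj Nfa.
  have [|beta []] := H m g ms; first by rewrite -gE.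
  by rewrite -gE => /disj.
- move=> H; apply: contrapT => nca.
  have [f [fa disj]] : exists f, basic_open f alpha /\ basic_open f `<=` ~` Spec_c A.
    apply: contrapT => nf; apply: nca.
    apply/closure_basicP => f fa; apply: contrapT => nE; apply: nf; exists f.
    split=> // beta fb cb; apply: nE.
    have [Q fQ] := Spec_c_field_point cb fb.
    by exists (Spec_r_map (@tofrac A) Q); split=> //; exists Q.
  have [m [g [ms gE]]] := basic_open_shrink disj fa.
  have ga : basic_open g alpha by rewrite -gE.
  have [[_ PN1] _] := pos_coneP alpha; apply/PN1/(H m g ms ga) => /=.
  rewrite rmorphN1; apply: contrapT => CN1.
  have /(basic_open_meets_Spec_c (basic_open_neq0 ga))[beta []] :
    proper_cone (frac_cone g) by split=> //; exact: cone_adjoin_cone.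
  by rewrite -gE => /disj.
Qed.
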